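(* Let $X,Y$ be normed linear spaces and let $\Sigma=(S,h,\phi)$ be a dynamical system with output, with $S\subseteq X$ and $h:S\to Y$. Let $\Omega\subseteq S$ be a non-empty set such that $\phi(t,\Omega)\subseteq\Omega$ for all $t\ge0$, $0\in\Omega$, $h(0)=0$ and $\phi(t,0)=0$ for all $t\ge0$. Suppose that there exist a function $a\in K_\infty$, continuous functionals $V,W:\Omega\to\mathbb{R}_+$ with $\sup\{V(x)+W(x):x\in\Omega,\ \|x\|_X\le s\}<+\infty$ for all $s\ge0$, and a continuous, positive definite function $\rho:\mathbb{R}_+\to\mathbb{R}_+$ such that $$a(\|h(x)\|_Y)\le W(x)\quad\text{for all }x\in\Omega,$$ $$V(\phi(t,x))\le V(x)-\int_0^t\rho(W(\phi(s,x)))\,ds\quad\text{for all }x\in\Omega,\ t\ge0.$$ Moreover, suppose that for every $x\in\Omega$ the mapping $t\mapsto W(\phi(t,x))$ is non-increasing. Then $\Sigma$ is Uniformly Asymptotically Output Stable (UAOS) on $\Omega$.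
   Context: $\mathbb{R}_+=[0,+\infty)$. $K_\infty$ is the class of strictly increasing continuous functions $a:\mathbb{R}_+\to\mathbb{R}_+$ with $a(0)=0$ and $\lim_{s\to+\infty}a(s)=+\infty$. A function $\rho:\mathbb{R}_+\to\mathbb{R}_+$ is positive definite if $\rho(0)=0$ and $\rho(s)>0$ for $s>0$. A (continuous-time, deterministic, autonomous) dynamical system with output is a triplet $\Sigma=(S,h,\phi)$ consisting of a non-empty set $S\subseteq X$ (state space), a mapping $h:S\to Y$ (output map) and a mapping $\phi:\mathbb{R}_+\times S\to S$ satisfying $\phi(0,x)=x$ for all $x\in S$ and $\phi(t,\phi(s,x))=\phi(t+s,x)$ for all $x\in S$ and $t,s\ge0$. (No continuity of $\phi$ or $h$ is part of this definition.) Write $y(t,x_0)=h(\phi(t,x_0))$ and $B_R=\{x\in X:\|x\|_X<R\}$. The system $\Sigma$ is: - Lagrange output stable on $\Omega$ if for every $R>0$ the set $\{\|y(t,x_0)\|_Y:x_0\in B_R\cap\Omega,\ t\ge0\}$ is bounded; - Lyapunov output stable on $\Omega$ if for every $\varepsilon>0$ there exists $\delta(\varepsilon)>0$ such that for all $x_0\in B_{\delta(\varepsilon)}\cap\Omega$ it holds that $\|y(t,x_0)\|_Y\le\varepsilon$ for all $t\ge0$; - UAOS on $\Omega$ if it is Lagrange and Lyapunov output stable on $\Omega$ and for every $\varepsilon,R>0$ there exists $T(\varepsilon,R)>0$ such that for all $x_0\in B_R\cap\Omega$ it holds that $\|y(t,x_0)\|_Y\le\varepsilon$ for all $t\ge T(\varepsilon,R)$.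 *)

(* Defs.v *)
From HB Require Import structures.
From mathcomp Require Import all_boot all_order all_algebra.
From mathcomp Require Import all_classical all_reals all_analysis.
Set Implicit Arguments.
Unset Strict Implicit.
Unset Printing Implicit Defensive.
Import Order.TTheory GRing.Theory Num.Theory.
Import numFieldNormedType.Exports.

Local Open Scope classical_set_scope.
Local Open Scope ring_scope.

(* A function with domain A (a half-line, a state space, ...) is represented
   by a total function of which only the values on A are ever constrained or
   used; its continuity is continuity for the subspace topology of A, written
   {within A, continuous _}. *)

Definition Rplus (R : realType) : set R := [set` `[0, +oo[].
Arguments Rplus : clear implicits.

Definition K_infty (R : realType) (a : R -> R) : Prop :=
  [/\ a @` Rplus R `<=` Rplus R,
      {within Rplus R, continuous a},
      {in Rplus R &, forall s t, s < t -> a s < a t},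
      a 0 = 0
    & a s @[s --> +oo] --> +oo].

Definition positive_definite (R : realType) (rho : R -> R) : Prop :=
  [/\ rho @` Rplus R `<=` Rplus R,
      rho 0 = 0
    & forall s, 0 < s -> 0 < rho s].

Record output_system (R : realType) (X Y : normedModType R) := OutputSystem {
  state : set X;
  output : X -> Y;
  flow : R -> X -> X;
  state_nonempty : state !=set0;
  flow_state : forall t x, Rplus R t -> state x -> state (flow t x);
  flow_id : forall x, state x -> flow 0 x = x;
  flow_comp : forall t s x, Rplus R t -> Rplus R s -> state x ->
    flow t (flow s x) = flow (t + s) x
}.

Section Stability.
Context (R : realType) (X Y : normedModType R).
Variables (Sigma : output_system X Y) (Omega : set X).

Definition trajectory (t : R) (x0 : X) : Y := output Sigma (flow Sigma t x0).

Definition centered_ball (r : R) : set X := [set x | `|x| < r].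

Definition Lagrange_output_stable : Prop :=
  forall r : R, 0 < r ->
    bounded_set [set `|trajectory t x0|
                | x0 in centered_ball r `&` Omega & t in Rplus R].

Definition Lyapunov_output_stable : Prop :=
  forall eps : R, 0 < eps -> exists2 delta : R, 0 < delta &
    forall x0, (centered_ball delta `&` Omega) x0 ->
      forall t, Rplus R t -> `|trajectory t x0| <= eps.

Definition UAOS : Prop :=
  [/\ Lagrange_output_stable,
      Lyapunov_output_stable
    & forall eps r : R, 0 < eps -> 0 < r -> exists2 T : R, 0 < T &
        forall x0, (centered_ball r `&` Omega) x0 ->
          forall t, T <= t -> `|trajectory t x0| <= eps].

End Stability.

(* Main.v *)
(** Since W is non-increasing along trajectories and dominates a(|y|), Lagrange
    and Lyapunov stability only need W to be bounded on balls, continuous at 0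
    and zero at 0; the latter follows from the decay inequality along the
    equilibrium, where the integrand is the constant rho(W(0)).  For
    attractivity, let M bound V and W on the ball of radius r.  If
    W(phi(t,x)) > a(eps), then W(phi(s,x)) stays in the compact interval
    [a(eps), max(M, a(eps))] for s <= t, on which rho has a positive minimum c,
    so c t <= V(x) <= M, which bounds t. *)
Require Import Defs.
From HB Require Import structures.
From mathcomp Require Import all_boot all_order all_algebra.
From mathcomp Require Import all_classical all_reals all_analysis.
From mathcomp Require Import lra.
Set Implicit Arguments.
Unset Strict Implicit.
Unset Printing Implicit Defensive.
Import Order.TTheory GRing.Theory Num.Theory.
Import numFieldNormedType.Exports.
Local Open Scope classical_set_scope.
Local Open Scope ring_scope.

(* No measurability of f is required: the integral of a nonnegative function is
   a supremum over the simple functions below it. *)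
Lemma cst_le_integral d (T : measurableType d) (R : realType)
    (mu : {measure set T -> \bar R}) (D : set T) (f : T -> \bar R) (c : R) :
  measurable D -> 0 <= c -> (forall x, D x -> (c%:E <= f x)%E) ->
  (c%:E * mu D <= \int[mu]_(x in D) f x)%E.
Proof.
move=> mD c0 cf.
rewrite -integral_cst// !ge0_integralE//; last first.
  by move=> x Dx; rewrite (le_trans _ (cf x Dx))// lee_fin.
(* A simple function below the constant [c] on [D] is also below [f], so the left supremum runs over
   a subset of the right one. *)
apply: ge_ereal_sup => _ [g gle <-]; apply: ereal_sup_ubound.
exists g => // x; apply: (le_trans (gle x)); rewrite !patchE.
by case: ifPn => // /set_mem/cf.
Qed.

Theorem theorem4 (R : realType) (X Y : normedModType R)
    (Sigma : output_system X Y) (Omega : set X)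
    (Omega_state : Omega `<=` state Sigma)
    (Omega_nonempty : Omega !=set0)
    (Omega_invariant : forall t, Rplus R t -> flow Sigma t @` Omega `<=` Omega)
    (Omega0 : Omega 0)
    (output0 : output Sigma 0 = 0)
    (flow0 : forall t, Rplus R t -> flow Sigma t 0 = 0)
    (a : R -> R) (a_K_infty : K_infty a)
    (V W : X -> R)
    (V_ge0 : V @` Omega `<=` Rplus R)
    (W_ge0 : W @` Omega `<=` Rplus R)
    (V_cont : {within Omega, continuous V})
    (W_cont : {within Omega, continuous W})
    (VW_bounded : forall s, Rplus R s ->
      (ereal_sup [set (V x + W x)%R%:E | x in Omega `&` [set x | `|x| <= s]%R]
        < +oo)%E)
    (rho : R -> R)
    (rho_cont : {within Rplus R, continuous rho})
    (rho_pd : positive_definite rho)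
    (output_le : forall x, Omega x -> a `|output Sigma x| <= W x)
    (V_decay : forall x t, Omega x -> Rplus R t ->
      ((V (flow Sigma t x))%:E <= (V x)%:E -
        \int[lebesgue_measure]_(s in `[0%R, t]) (rho (W (flow Sigma s x)))%:E)%E)
    (W_nonincreasing : forall x, Omega x ->
      {in Rplus R &, nonincreasing_fun (fun t => W (flow Sigma t x))}) :
  UAOS Sigma Omega.
Proof.
have [_ _ a_incr a0 a_infty] := a_K_infty.
have [_ _ rho_gt0] := rho_pd.
have RplusE t : Rplus R t = (0 <= t) :> Prop.
  by rewrite /Rplus /= in_itv/= andbT.
have a_gt0 e : 0 < e -> 0 < a e.
  by move=> e0; rewrite -a0 a_incr// inE RplusE// ltW.
have a_le_inv s e : 0 <= s -> 0 < e -> a s <= a e -> s <= e.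
  move=> s0 e0 ase; rewrite leNgt; apply/negP => es.
  by move: ase; rewrite leNgt a_incr// inE RplusE// ltW.
have Omega_flow x t : Omega x -> 0 <= t -> Omega (flow Sigma t x).
  by move=> Ox t0; apply: (Omega_invariant t); [rewrite RplusE|exists x].
have VP x : Omega x -> 0 <= V x.
  by move=> Ox; rewrite -RplusE; apply: V_ge0; exists x.
have WP x : Omega x -> 0 <= W x.
  by move=> Ox; rewrite -RplusE; apply: W_ge0; exists x.
have W_flow_le x s t : Omega x -> 0 <= s -> s <= t ->
    W (flow Sigma t x) <= W (flow Sigma s x).
  move=> Ox s0 st; apply: W_nonincreasing => //; rewrite inE RplusE//.
  exact: le_trans st.
have W_flow_le0 x t : Omega x -> 0 <= t -> W (flow Sigma t x) <= W x.
  move=> Ox t0; have := W_flow_le x 0 t Ox (lexx _) t0.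
  by rewrite flow_id//; exact: Omega_state.
have a_traj x t : Omega x -> 0 <= t ->
    a `|trajectory Sigma t x| <= W (flow Sigma t x).
  by move=> Ox t0; apply: output_le; exact: Omega_flow.
have VW_bound r : 0 < r -> exists2 M, 0 < M &
    forall x, `|x| < r -> Omega x -> V x <= M /\ W x <= M.
  move=> r0.
  have /VW_bounded : Rplus R r by rewrite RplusE ltW.
  set B := ereal_sup _ => Boo.
  have ubB x : `|x| < r -> Omega x -> ((V x + W x)%:E <= B)%E.
    move=> xr Ox; apply: ereal_sup_ubound; exists x => //; split => //=.
    exact: ltW.
  (* [B] is finite, being at least [V 0 + W 0]; the added 1 makes the bound positive even if [B] is
     0. Since [V] and [W] are nonnegative, bounding their sum bounds each. *)
  exists (fine B + 1).
    have := ubB 0; rewrite normr0 => /(_ r0 Omega0).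
    move: Boo ubB; case: B => [b| |]//= _ _; rewrite lee_fin => Vb.
    by rewrite ltr_wpDl// (le_trans _ Vb)// addr_ge0 ?VP ?WP.
  move=> x xr Ox; have := ubB x xr Ox; have := VP _ Ox; have := WP _ Ox.
  move: Boo {ubB}; case: B => [b| |]//= _ W0 V0; rewrite lee_fin => Vb.
  by split; lra.
have V_integral_le x t c : Omega x -> 0 <= t -> 0 <= c ->
    (forall s, 0 <= s -> s <= t -> c <= rho (W (flow Sigma s x))) ->
    c * t <= V x.
  move=> Ox t0 c0 crho.
  have cI : ((c * t)%:E <=
      \int[lebesgue_measure]_(s in `[0%R, t]) (rho (W (flow Sigma s x)))%:E)%E.
    have mt : lebesgue_measure (`[0, t] : set R) = t%:E.
      rewrite lebesgue_measure_itv/= lte_fin oppr0 adde0.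
      by case: (ltgtP 0 t) t0 => // <-.
    rewrite EFinM -mt; apply: cst_le_integral => //= s; rewrite in_itv/=.
    by case/andP => s0 st; rewrite lee_fin crho.
  have tp : Rplus R t by rewrite RplusE.
  have := V_decay x t Ox tp; have := VP _ (Omega_flow x t Ox t0).
  (* The value [-oo] contradicts [cI], and [+oo] would force a real value of [V] below [-oo]. *)
  move: cI; case: integral => [i| |]//=.
  by rewrite -EFinD !lee_fin; lra.
have W0 : W 0 = 0.
  apply/eqP; rewrite eq_le WP// andbT leNgt; apply/negP => /rho_gt0 rW.
  have tp (t : R) : 0 <= t -> flow Sigma t 0 = 0.
    by move=> t0; apply: flow0; rewrite RplusE.
  (* At this time the equilibrium would have dissipated [V 0 + 1], more than the available [V 0]. *)
  pose t := (V 0 + 1) / rho (W 0).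
  have V0 := VP _ Omega0.
  have t0 : 0 <= t by rewrite divr_ge0 ?ltW// ltr_wpDl.
  have : rho (W 0) * t <= V 0.
    by apply: V_integral_le => //; [exact: ltW|move=> s s0 _; rewrite tp].
  by rewrite mulrC divfK ?gt_eqF// leNgt ltrDl ltr01.
split.
- move=> r r0; have [M M0 VWM] := VW_bound r r0.
  (* An output norm above [b] would make [a] exceed [M], which bounds [W] along the whole
     trajectory. *)
  have /cvgryPgt/(_ M)[b [_ bM]] := a_infty.
  exists `|b|; split => //= K bK _ /= [x [xr Ox] [t + <-]]; rewrite RplusE => t0.
  rewrite !normr_id leNgt; apply/negP => /(lt_trans bK) bt.
  have := bM _ (le_lt_trans (ler_norm b) bt).
  rewrite ltNge => /negP; apply; have [_] := VWM x xr Ox; apply: le_trans.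
  exact: le_trans (a_traj x t Ox t0) (W_flow_le0 x t Ox t0).
- move=> e e0; have ae0 := a_gt0 _ e0.
  (* Near 0 in [Omega], [W] stays below [a e]; monotonicity along the flow extends this from the
     initial state to all times. *)
  have /subspace_continuousP/(_ 0 Omega0)/cvgrPdist_lt/(_ _ ae0) := W_cont.
  rewrite near_withinE => /nbhs_normP[d/= d0 dW]; exists d => // x [xd Ox] t.
  rewrite RplusE => t0; apply: a_le_inv => //.
  apply: (le_trans (a_traj x t Ox t0)); apply: (le_trans (W_flow_le0 x t Ox t0)).
  have := dW x; rewrite /= sub0r normrN => /(_ xd Ox).
  by rewrite /from_subspace W0 sub0r normrN ger0_norm ?WP//; exact: ltW.
- move=> e r e0 r0; have [M M0 VWM] := VW_bound r r0.
  have ae0 := a_gt0 _ e0.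
  have [c c0 c_min] : exists2 c, 0 < c &
      forall w, a e <= w <= Num.max M (a e) -> c <= rho w.
    (* The maximum keeps the interval nonempty when [M < a e], so that the minimum of [rho] is
       attained on it. *)
    have aM : a e <= Num.max M (a e) by rewrite le_max lexx orbT.
    have rho_cc : {within `[a e, Num.max M (a e)], continuous rho}.
      apply: continuous_subspaceW rho_cont => w/=; rewrite RplusE in_itv/=.
      by case/andP => /(le_trans (ltW ae0)).
    have [w] := EVT_min aM rho_cc.
    rewrite in_itv/= => /andP[aw _] wmin; exists (rho w).
      by apply: rho_gt0; exact: lt_le_trans aw.
    by move=> v av; apply: wmin; rewrite in_itv.
  (* The added 1 gives the strict [M < c * t] from this time on, against [c * t <= V x <= M]. *)
  exists (M / c + 1); first by rewrite ltr_wpDl// divr_ge0// ltW.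
  move=> x [xr Ox] t Tt; have [VM WM] := VWM x xr Ox.
  have t0 : 0 <= t by apply: le_trans Tt; rewrite addr_ge0// divr_ge0// ltW.
  apply: a_le_inv => //; apply: (le_trans (a_traj x t Ox t0)).
  rewrite leNgt; apply/negP => aW.
  have : c * t <= V x.
    apply: V_integral_le => //; first exact: ltW.
    (* Monotonicity places [W] at time [s] between its value at [t], above [a e], and its initial
       value, at most [M]. *)
    move=> s s0 st; apply: c_min; apply/andP; split.
      exact: le_trans (ltW aW) (W_flow_le x s t Ox s0 st).
    by rewrite le_max (le_trans (W_flow_le0 x s Ox s0) WM).
  apply/negP; rewrite -ltNge (le_lt_trans VM)// mulrC -ltr_pdivrMr//.
  by rewrite (lt_le_trans _ Tt)// ltrDl.
Qed.
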